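(* Let $f:\mathbb{R}^n\to\mathbb{R}$ and $g:\mathbb{R}^m\to\mathbb{R}$ be continuously differentiable and convex, let $A\in\mathbb{R}^{m\times n}$ with $m\ge n$ have full column rank, and let $V(x)=f(x)+g(Ax)$. Let $t_0>0$ and let $X:[t_0,\infty)\to\mathbb{R}^n$ be a trajectory of the A-ADMM flow $$\ddot X+\frac{r}{t}\dot X+(A^TA)^{-1}\nabla V(X)=0$$ with initial conditions $X(t_0)=x_0$ and $\dot X(t_0)=0$. Assume that $\operatorname{argmin}V\neq\emptyset$ and let $V^\star=\min_xV(x)$. If $r\ge3$, then there is some constant $C>0$ such that $$V(X(t))-V^\star\le\frac{C}{t^2}$$ for all $t\ge t_0$.
   Context: A trajectory is a twice differentiable curve satisfying the differential equation for all $t\ge t_0$. The constant $C$ may depend on the trajectory (in particular on $x_0$, $t_0$ and $r$) but not on $t$. *)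

(* Defs.v *)
From HB Require Import structures.
From mathcomp Require Import all_boot all_order all_algebra.
From mathcomp Require Import boolp classical_sets reals topology normedtype.
From mathcomp Require Import derive convex.

Set Implicit Arguments.
Unset Strict Implicit.
Unset Printing Implicit Defensive.
Import Order.TTheory GRing.Theory Num.Theory.
Import numFieldNormedType.Exports.
Local Open Scope classical_set_scope.
Local Open Scope ring_scope.

(* The vector of partial derivatives; 'D_v is a total operator, so this is the
   gradient only where F is differentiable. *)
Definition grad (R : realType) (n : nat) (F : 'cV[R]_n -> R)
    (x : 'cV[R]_n) : 'cV[R]_n :=
  \col_(i < n) 'D_(delta_mx i 0) F x.

Definition continuously_differentiable (R : realType) (n : nat)
    (F : 'cV[R]_n -> R) : Prop :=
  (forall x, differentiable F x) /\ continuous (grad F).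

(* X' is the derivative on [t0, +oo[ of the restriction of X to [t0, +oo[: the
   derivative at t0 is one-sided, and the values of X and X' before t0 are
   irrelevant. *)
Definition is_derive_from (R : realType) (n : nat) (t0 : R)
    (X X' : R -> 'cV[R]_n) : Prop :=
  forall t, t0 <= t ->
    (s - t)^-1 *: (X s - X t) @[s --> within [set s | t0 <= s] t^'] --> X' t.

(* Twice differentiable solutions on [t0, +oo[ of
   X'' + (r / t) X' + (A^T A)^-1 grad V (X) = 0, X t0 = x0, X' t0 = 0;
   invmx is the inverse only when A^T A is invertible, i.e. when A has full
   column rank. *)
Definition is_AADMM_trajectory (R : realType) (m n : nat) (A : 'M[R]_(m, n))
    (V : 'cV[R]_n -> R) (r t0 : R) (x0 : 'cV[R]_n) (X : R -> 'cV[R]_n) : Prop :=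
  exists X' X'' : R -> 'cV[R]_n,
    [/\ is_derive_from t0 X X',
        is_derive_from t0 X' X'',
        forall t, t0 <= t ->
          X'' t + (r / t) *: X' t + invmx (A^T *m A) *m grad V (X t) = 0,
        X t0 = x0 &
        X' t0 = 0].

Definition argmin (R : realType) (T : Type) (V : T -> R) : set T :=
  [set x | forall y, V x <= V y].

Definition is_min (R : realType) (T : Type) (V : T -> R) (v : R) : Prop :=
  range V v /\ lbound (range V) v.

(* Main.v *)
(* Lyapunov argument, for the inner product <u, v> = u^T (A^T A) v, in which
   (A^T A)^-1 grad V is the gradient of V. Let x* be a minimizer and let
   W = (r - 1) (X - x* ) + t X'. The equation reads W' = - t (A^T A)^-1 grad V(X),
   so the energy E = t^2 (V(X) - V* ) + |A W|^2 / 2 satisfies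
   E' = 2 t (V(X) - V* ) - (r - 1) t grad V(X) . (X - x* ),
   which convexity bounds by (3 - r) t (V(X) - V* ) <= 0. Hence
   t^2 (V(X) - V* ) <= E(t) <= E(t0). *)
Require Import Defs.
From HB Require Import structures.
From mathcomp Require Import all_boot all_order all_algebra.
From mathcomp Require Import boolp classical_sets reals topology normedtype.
From mathcomp Require Import derive convex interval_inference functions.
From mathcomp Require Import ring lra.

Set Implicit Arguments.
Unset Strict Implicit.
Unset Printing Implicit Defensive.
Import Order.TTheory GRing.Theory Num.Theory.
Import numFieldNormedType.Exports.
Local Open Scope classical_set_scope.
Local Open Scope ring_scope.

(** * Calculus of matrix-valued curves, and the tangent inequality for convex functions *)

Section Differentiation.
Context {R : realType}.

(** Each entry of [B *m M] is a finite linear combination of coordinates of [M], and the norm is the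
    largest absolute value of an entry. *)
Lemma mulmx_continuous m n p (B : 'M[R]_(m, n)) :
  continuous (mulmx B : 'M[R]_(n, p) -> 'M[R]_(m, p)).
Proof.
move=> N; apply/(@cvgrPdist_le _ _ _ _ (nbhs_filter N)) => e e0.
have Bij ij : \forall M \near N,
    `|(B *m N) ij.1 ij.2 - (B *m M) ij.1 ij.2| <= e.
  suff : (B *m M) ij.1 ij.2 @[M --> N] --> (B *m N) ij.1 ij.2.
    by move/(@cvgrPdist_le _ _ _ _ (nbhs_filter N)); apply.
  apply/differentiable_continuous; case: ij => i j /=.
  rewrite (_ : (fun M => _) = \sum_k (B i k *: (fun M : 'M[R]_(n, p) => M k j))).
    by apply: differentiable_sum => k; exact/differentiableZ/differentiable_coord.
  by apply/funext => M; rewrite mxE fct_sumE.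
near=> M.
rewrite [leLHS]/Num.Def.normr/= mx_normrE (bigmax_le _ (ltW e0))//= => ij _.
rewrite mxE [X in _ + X]mxE; move: ij; near: M.
by apply: (@filter_forall _ _ _ _ (nbhs_filter N)).
Unshelve. all: by end_near. Qed.

Lemma is_diff_mulmx m n p (B : 'M[R]_(m, n)) (N : 'M[R]_(n, p)) :
  is_diff N (mulmx B) (mulmx B).
Proof.
by apply: DiffDef; [apply: linear_differentiable|apply: diff_lin];
  exact: mulmx_continuous.
Qed.

Lemma is_derive_diff_comp (V W : normedModType R) (F : V -> W) (dF : V -> W)
    (Y : R -> V) (dY : V) (t : R) :
  is_diff (Y t) F dF -> is_derive t 1 Y dY -> is_derive t 1 (F \o Y) (dF dY).
Proof.
move=> dFY [/derivable1_diffP Yd <-].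
have Fd : differentiable F (Y t) by [].
have FYd : differentiable (F \o Y) t by exact: differentiable_comp.
apply: DeriveDef; first exact/derivable1_diffP.
by rewrite !deriveE// diff_comp//= diff_val.
Qed.

Lemma is_derive_coord m n (Y : R -> 'M[R]_(m, n)) dY (t : R) i j :
  is_derive t 1 Y dY -> is_derive t 1 (fun s => Y s i j) (dY i j).
Proof.
move=> [Yd <-]; apply: DeriveDef; first exact: (derivable_mxP _ _ _).1.
by rewrite derive_mx// mxE.
Qed.

Lemma is_derive_mx m n (Y : R -> 'M[R]_(m, n)) (dY : 'M[R]_(m, n)) (t : R) :
  (forall i j, is_derive t 1 (fun s => Y s i j) (dY i j)) -> is_derive t 1 Y dY.
Proof.
move=> Yd; have Yt : derivable Y t 1 by apply/derivable_mxP => i j; case: (Yd i j).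
apply: DeriveDef => //; rewrite derive_mx//.
by apply/matrixP => i j; rewrite mxE derive_val.
Qed.

Lemma sum_sqr_continuous n :
  continuous (fun u : 'cV[R]_n => \sum_i u i 0 ^+ 2).
Proof.
move=> u; apply/differentiable_continuous.
rewrite (_ : (fun _ => _) = \sum_i (fun u : 'cV[R]_n => u i 0) ^+ 2).
  apply: differentiable_sum => i; apply: differentiableX.
  exact: differentiable_coord.
by apply/funext => v; rewrite fct_sumE.
Qed.

Lemma is_derive_sum_sqr n (Y : R -> 'cV[R]_n) dY (t : R) :
  is_derive t 1 Y dY ->
  is_derive t 1 (fun s => \sum_i Y s i 0 ^+ 2) (2 * \sum_i Y t i 0 * dY i 0).
Proof.
move=> Yd.
rewrite (_ : (fun _ => _) = \sum_i (fun s => Y s i 0) ^+ 2); last first.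
  by apply/funext => s; rewrite fct_sumE.
rewrite mulr_sumr; apply: is_derive_sum => i.
have Yid := is_derive_coord i 0 Yd.
by apply: is_derive_eq; rewrite [RHS]mulrA.
Qed.

(** Expand [v] in the canonical basis and use linearity of the differential. *)
Lemma diff_grad n (F : 'cV[R]_n -> R) x v :
  differentiable F x -> 'd F x v = \sum_i v i 0 * grad F x i 0.
Proof.
move=> Fd; have {1}-> : v = \sum_i v i 0 *: delta_mx i 0.
  by rewrite [LHS]matrix_sum_delta; under eq_bigr do rewrite big_ord1.
rewrite linear_sum; apply: eq_bigr => i _.
by rewrite linearZ /grad mxE deriveE.
Qed.

(** For [0 < h <= 1], convexity bounds the difference quotient of [F] at [x] along [y - x] by
    [F y - F x]; let [h] tend to 0 from the right. *)
Lemma convex_diff_le (E : normedModType R) (F : E -> R) x y :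
  convex_function [set: E] F -> differentiable F x ->
  'd F x (y - x) <= F y - F x.
Proof.
move=> Fc Fd; rewrite -deriveE//.
have Dc : derivable F x (y - x) by exact: diff_derivable.
rewrite /derive (cvg_at_rightE _ _ Dc); apply: limr_le.
  by have /cvg_ex[l /cvg_dnbhs_at_right Dl] := Dc; apply/cvg_ex; exists l.
near=> h.
have h0 : 0 < h by [].
have h1 : h <= 1 by near: h; exact: nbhs_right_le.
have Fh : F (h *: y + (1 - h) *: x) <= h * F y + (1 - h) * F x.
  exact: (Fc (Itv01 (ltW h0) h1) y x (in_setT _) (in_setT _)).
rewrite /= ler_pdivrMl// lerBlDr.
have -> : h *: (y - x) + x = h *: y + (1 - h) *: x.
  by rewrite scalerBr scalerBl scale1r addrAC addrA.
by apply: le_trans Fh _; lra.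
Unshelve. all: by end_near. Qed.

End Differentiation.

(** * From derivatives on a closed ray to interior derivatives and right-continuity *)

Lemma is_derive_from_is_derive (R : realType) (n : nat) (t0 t : R)
    (X X' : R -> 'cV[R]_n) :
  is_derive_from t0 X X' -> t0 < t -> is_derive t 1 X (X' t).
Proof.
move=> XX' t0t.
suff h : h^-1 *: (X (h *: 1 + t) - X t) @[h --> 0^'] --> X' t.
  by apply: DeriveDef; [apply/cvg_ex; exists (X' t)|exact: cvg_lim h].
have shift_cvg : h *: 1 + t @[h --> (0 : R)^'] --> within [set s | t0 <= s] t^'.
  (* The radius is capped at [t - t0] so that [h + t] stays in the ray, where the restricted filter
     sees no constraint. *)
  move=> P /= /nbhs_ballP[e /= e0 eP].
  apply/nbhs_ballP; exists (Num.min e (t - t0)) => /=.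
    by rewrite lt_min e0 subr_gt0.
  move=> h; rewrite /ball/= sub0r normrN lt_min => /andP[he ht] h0.
  rewrite [_ *: _]mulr1; apply: eP.
  - by rewrite /ball/= opprD addrCA subrr addr0 normrN.
  - by rewrite -subr_eq0 addrK.
  - by rewrite /= -lerBlDr; have := lerNnormlW (ltW ht); lra.
have := cvg_comp _ _ shift_cvg (XX' _ (ltW t0t)).
apply: cvg_trans; apply: near_eq_cvg; near=> h.
by rewrite /= addrK [h *: 1]mulr1.
Unshelve. all: by end_near. Qed.

(** Write [X s] as [X t0] plus [s - t0] times the difference quotient; the product tends to
    [0 *: X' t0]. *)
Lemma is_derive_from_cvg (R : realType) (n : nat) (t0 : R)
    (X X' : R -> 'cV[R]_n) :
  is_derive_from t0 X X' -> X s @[s --> t0^'+] --> X t0.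
Proof.
move=> XX'.
have sub : t0^'+ `=>` within [set s | t0 <= s] t0^'.
  move=> P Ps; apply: (@filterS _ (nbhs t0) _ _ _ _ Ps) => s {}Ps t0s.
  apply: Ps; last exact: ltW.
  by rewrite gt_eqF.
have XX't0 : (s - t0)^-1 *: (X s - X t0) @[s --> t0^'+] --> X' t0.
  by apply: cvg_trans (XX' _ (lexx t0)); apply: cvg_app.
have s0 : s - t0 @[s --> t0^'+] --> 0.
  by apply: cvg_at_right_filter; rewrite -(subrr t0); apply: cvgB => //; exact: cvg_cst.
have : (s - t0) *: ((s - t0)^-1 *: (X s - X t0)) + X t0 @[s --> t0^'+] --> X t0.
  rewrite -[X in _ --> X]add0r -(scale0r (X' t0)).
  by apply: cvgD; [exact: cvgZ|exact: cvg_cst].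
apply: cvg_trans; apply: near_eq_cvg; near=> s.
rewrite /= scalerA mulfV ?scale1r ?subrK// subr_eq0.
by near: s; exact: nbhs_right_neq.
Unshelve. all: by end_near. Qed.

(** * The Gram matrix of [A] and its inner product *)

Lemma gram_unitmx (R : realFieldType) (m n : nat) (A : 'M[R]_(m, n)) :
  \rank A = n -> A^T *m A \in unitmx.
Proof.
move=> rA; rewrite -row_free_unit; apply/inj_row_free => u uAA.
have AT : row_free A^T by rewrite /row_free mxrank_tr rA.
apply: (row_free_inj AT); rewrite mul0mx.
(* The only entry of this matrix is the sum of the squares of the entries of [u *m A^T], so its
   vanishing forces [u *m A^T = 0]; full rank then gives [u = 0]. *)
have : (u *m A^T) *m (u *m A^T)^T = 0.
  by rewrite trmx_mul trmxK mulmxA -(mulmxA u) uAA mul0mx.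
move=> /matrixP/(_ 0 0); rewrite !mxE => /eqP.
rewrite psumr_eq0 => [/allP h|i _]; last by rewrite [X in _ * X]mxE -expr2 sqr_ge0.
apply/rowP => i; have := h i (mem_index_enum _).
by rewrite [X in _ * X]mxE -expr2 sqrf_eq0 => /eqP ->; rewrite mxE.
Qed.

(** Both sides are the entry of [u^T *m A^T *m A *m v]. This brings out the factor [A^T *m A] that
    cancels the inverse in the equation. *)
Lemma gram_dot (R : comPzRingType) (m n : nat) (A : 'M[R]_(m, n))
    (u v : 'cV[R]_n) :
  \sum_i (A *m u) i 0 * (A *m v) i 0 = \sum_j u j 0 * (A^T *m A *m v) j 0.
Proof.
have dotE k (a b : 'cV[R]_k) : \sum_i a i 0 * b i 0 = (a^T *m b) 0 0.
  by rewrite mxE; apply: eq_bigr => i _; rewrite mxE.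
by rewrite !dotE trmx_mul !mulmxA.
Qed.

Theorem theorem9 (R : realType) (m n : nat)
    (f : 'cV[R]_n -> R) (g : 'cV[R]_m -> R)
    (f_C1 : continuously_differentiable f)
    (g_C1 : continuously_differentiable g)
    (f_convex : convex_function [set: 'cV[R]_n] f)
    (g_convex : convex_function [set: 'cV[R]_m] g)
    (A : 'M[R]_(m, n)) (le_nm : (n <= m)%N) (rank_A : \rank A = n)
    (V : 'cV[R]_n -> R) (V_def : forall x, V x = f x + g (A *m x))
    (r t0 : R) (t0_gt0 : 0 < t0)
    (x0 : 'cV[R]_n) (X : R -> 'cV[R]_n)
    (X_traj : is_AADMM_trajectory A V r t0 x0 X)
    (argminV : argmin V !=set0)
    (Vstar : R) (Vstar_min : is_min V Vstar)
    (r_ge3 : 3 <= r) :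
  exists2 C : R, 0 < C &
    forall t, t0 <= t -> V (X t) - Vstar <= C / t ^+ 2.
Proof.
have [X' [X'' [XX' X'X'' ode _ _]]] := X_traj.
have [[xs _ Vxs] Vstar_lb] := Vstar_min.
have V_ge x : Vstar <= V x by apply: Vstar_lb; exists x.
have VE : V = f + (g \o mulmx A) by apply/funext => x; rewrite V_def.
have V_diff x : differentiable V x.
  rewrite VE; apply: differentiableD; first exact: f_C1.1.
  have dA := is_diff_mulmx A x.
  by apply: differentiable_comp; last exact: g_C1.1.
(* The tangent inequalities of [f] at [x] and of [g] at [A *m x] add up, since the chain rule sends
   [xs - x] to [A *m xs - A *m x]. *)
have V_convex x : 'd V x (xs - x) <= Vstar - V x.
  have dA := is_diff_mulmx A x.
  have dg := g_C1.1 (A *m x).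
  have df := f_C1.1 x.
  rewrite -Vxs VE diffD//; last exact: differentiable_comp.
  have dAE : 'd (mulmx A) x = mulmx A :> (_ -> _) by exact: diff_val.
  rewrite /= (diff_comp (f := mulmx A))//= dAE mulmxBr.
  have := lerD (convex_diff_le xs f_convex df) (convex_diff_le (A *m xs) g_convex dg).
  by move=> /le_trans; apply; rewrite /= addrACA opprD.
pose W t := (r - 1) *: (X t - xs) + t *: X' t.
(* Candidate derivative of [W]: the coefficient [r] is [r - 1] from the first term plus 1 from the
   product rule. *)
pose W' t := r *: X' t + t *: X'' t.
pose E t := t ^+ 2 * (V (X t) - Vstar) + 2^-1 * \sum_i (A *m W t) i 0 ^+ 2.
pose E' t := 2 * t * (V (X t) - Vstar) + t ^+ 2 * 'd V (X t) (X' t)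
  + \sum_i (A *m W t) i 0 * (A *m W' t) i 0.
have W_deriv t : t0 < t -> is_derive t 1 W (W' t).
  move=> t0t.
  have dX := is_derive_from_is_derive XX' t0t.
  have dX' := is_derive_from_is_derive X'X'' t0t.
  apply: is_derive_mx => i j.
  have dXij := is_derive_coord i j dX.
  have dX'ij := is_derive_coord i j dX'.
  rewrite (_ : (fun s => _) = (r - 1) *: ((fun s => X s i j) - cst (xs i j))
      + id * (fun s => X' s i j)); last by apply/funext => s; rewrite !mxE.
  apply: is_derive_eq; rewrite !mxE subr0 /GRing.scale/=; ring.
have E_deriv t : t0 < t -> is_derive t 1 E (E' t).
  move=> t0t.
  have dX := is_derive_from_is_derive XX' t0t.
  have dVX : is_derive t 1 (V \o X) ('d V (X t) (X' t)).
    exact: is_derive_diff_comp (differentiableP (V_diff _)) dX.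
  have dAW : is_derive t 1 (fun s => A *m W s) (A *m W' t).
    exact: (is_derive_diff_comp (is_diff_mulmx A (W t)) (W_deriv t t0t)).
  have dAW2 := is_derive_sum_sqr dAW.
  rewrite (_ : E = id ^+ 2 * (V \o X - cst Vstar) +
      2^-1 *: (fun s => \sum_i (A *m W s) i 0 ^+ 2)); last exact/funext.
  apply: is_derive_eq; rewrite /E' subr0 /GRing.scale/= mulKf ?pnatr_eq0//.
  rewrite !fctE/=; ring.
have E'_le0 t : t0 < t -> E' t <= 0.
  move=> t0t.
  have t_gt0 : 0 < t by exact: lt_trans t0t.
  (* Multiplying the equation by [t] gives [W'], as [t * (r / t) = r]; the Gram matrix then cancels
     its inverse. *)
  have gramW' : A^T *m A *m W' t = - t *: grad V (X t).
    have -> : W' t = - t *: (invmx (A^T *m A) *m grad V (X t)).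
      have -> : W' t = t *: (X'' t + (r / t) *: X' t).
        by rewrite scalerDr scalerA mulrCA divff ?gt_eqF// mulr1 addrC.
      have /eqP := ode t (ltW t0t); rewrite addr_eq0 => /eqP ->.
      by rewrite scalerN scaleNr.
    by rewrite -scalemxAr mulKVmx// gram_unitmx.
  (* Expanding [W] in the inner product yields [- t ^+ 2 * 'd V (X t) (X' t)], which cancels the
     same term of [E']. *)
  have -> : E' t = 2 * t * (V (X t) - Vstar) + t * (r - 1) * 'd V (X t) (xs - X t).
    rewrite /E' gram_dot gramW'.
    have -> : \sum_j W t j 0 * (- t *: grad V (X t)) j 0 = - t * 'd V (X t) (W t).
      rewrite diff_grad// mulr_sumr; apply: eq_bigr => j _.
      by rewrite [X in _ * X]mxE mulrCA.
    rewrite /W -(opprB xs) linearD !linearZ linearN /=.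
    rewrite /GRing.scale/=; ring.
  have := V_convex (X t); have := V_ge (X t).
  have : 0 < t * (r - 1) by rewrite mulr_gt0//; lra.
  set D := V (X t) - Vstar; set d := 'd V (X t) (xs - X t).
  move=> c_gt0 D_ge0 dD.
  have : t * (r - 1) * d <= t * (r - 1) * - D.
    by rewrite ler_pM2l//; rewrite /D; lra.
  (* After the convexity bound, what remains of [E'] is [2 * t * D - t * (r - 1) * D], the opposite
     of this quantity. *)
  have : 0 <= t * D * (r - 3).
    by rewrite mulr_ge0 ?mulr_ge0 ?(ltW t_gt0) ?subr_ge0.
  lra.
(* The derivative of [E] is known only for [t0 < t]; right-continuity at [t0] lets the monotonicity
   include the endpoint. *)
have E_cvg : E t @[t --> t0^'+] --> E t0.
  have cX := is_derive_from_cvg XX'.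
  have cX' := is_derive_from_cvg X'X''.
  have cid : s @[s --> t0^'+] --> t0 by exact: cvg_at_right_filter.
  have cW : W s @[s --> t0^'+] --> W t0.
    apply: cvgD; last exact: cvgZ.
    by apply: cvgZl_tmp; apply: cvgB => //; exact: cvg_cst.
  have cV : V (X s) @[s --> t0^'+] --> V (X t0).
    by apply: continuous_cvg => //; exact: differentiable_continuous.
  apply: cvgD.
    by apply: cvgM; [exact: cvgM|apply: cvgB => //; exact: cvg_cst].
  apply: cvgMl_tmp.
  apply: (continuous_cvg _ (@sum_sqr_continuous _ _ _)).
  exact: (continuous_cvg _ (@mulmx_continuous _ _ _ _ _ _)).
have E_noninc t : t0 <= t -> E t <= E t0.
  move=> t0t; apply: (@ler0_derive1_nincry _ E t0) => //.
  - move=> s; rewrite in_itv/= andbT => t0s.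
    by have [] := E_deriv s t0s.
  - move=> s; rewrite in_itv/= andbT => t0s.
    by have [_] := E_deriv s t0s; rewrite derive1E => ->; exact: E'_le0.
  - apply/continuous_within_itvcyP; split => // s; rewrite in_itv/= andbT => t0s.
    apply/differentiable_continuous/derivable1_diffP.
    by have [] := E_deriv s t0s.
(* Dropping this term from [E t] leaves [t ^+ 2 * (V (X t) - Vstar) <= E t]. *)
have sq_ge0 t : 0 <= 2^-1 * \sum_i (A *m W t) i 0 ^+ 2.
  by rewrite mulr_ge0 ?invr_ge0// sumr_ge0// => i _; exact: sqr_ge0.
(* [E t0] is nonnegative but vanishes when the trajectory starts at rest at [xs]; adding 1 makes the
   constant positive. *)
exists (E t0 + 1).
  rewrite ltr_wpDl// addr_ge0// mulr_ge0 ?sqr_ge0// subr_ge0//.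
move=> t t0t; have t_gt0 : 0 < t by exact: lt_le_trans t0t.
rewrite ler_pdivlMr ?exprn_gt0// mulrC.
by have := E_noninc t t0t; rewrite {1}/E; have := sq_ge0 t; lra.
Qed.
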